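(* Let $L\in\{\operatorname{Im}(\mathbb{I}),\mathbb{I}_0\}$, let $\Lambda$ be an icosahedral model set with underlying $\mathbb{Z}$-module $L$ and let $R>0$. Then the set $\mathcal{D}_{<R}(\Lambda)$ is determined by two $X$-rays in $L$-directions, i.e., there is a set $U\subset\mathbb{S}^2$ of two non-parallel $L$-directions such that $\mathcal{D}_{<R}(\Lambda)$ is determined by the $X$-rays in the directions of $U$.
   Context: Notation: $\tau=(1+\sqrt5)/2$; $.'$ is the non-trivial Galois automorphism of $\mathbb{Q}(\tau)$, so $\tau'=1-\tau$; $\mathbb{Z}[\tau]=\mathbb{Z}\oplus\mathbb{Z}\tau$. Modules: The icosian ring $\mathbb{I}$ is the additive subgroup of the Hamiltonian quaternions $\mathbb{H}\cong\mathbb{R}^4$ (basis $1,i,j,k$) generated by all even permutations of the coordinates of $(\pm1,0,0,0)$, $\tfrac12(\pm1,\pm1,\pm1,\pm1)$, $\tfrac12(0,\pm1,\pm\tau',\tau)$. For $\alpha=a+bi+cj+dk$ put $\operatorname{Im}(\alpha)=(b,c,d)^t\in\mathbb{R}^3$. $\operatorname{Im}(\mathbb{I})$ is the set of imaginary parts of all elements of $\mathbb{I}$, and $\mathbb{I}_0$ is the set of imaginary parts of those elements of $\mathbb{I}$ with real part $0$. Explicitly, $\operatorname{Im}(\mathbb{I})=\tfrac12\{(\beta,\gamma,\delta)^t\in\mathbb{Z}[\tau]^3\mid\tau^2\beta+\tau\gamma+\delta\equiv0\ (\mathrm{mod}\ 2)\}$ and $\mathbb{I}_0=\tfrac12\{(\beta,\gamma,\delta)^t\in\mathbb{Z}[\tau]^3\mid\beta\equiv\tau\gamma\equiv\tau^2\delta\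 (\mathrm{mod}\ 2)\}$. The star map $.^\star$ applies $.'$ to each coordinate of an element of $\mathbb{Q}(\tau)^3\supset L$. Icosahedral model sets: A window is a set $W\subset\mathbb{R}^3$ with $\varnothing\neq\operatorname{int}(W)\subset W\subset\operatorname{cl}(\operatorname{int}(W))$ and $\operatorname{cl}(\operatorname{int}(W))$ compact. Icosahedral model sets with underlying $\mathbb{Z}$-module $L$ are the sets $\Lambda_{\rm ico}(t,W)=t+\{\alpha\in L\mid\alpha^\star\in W\}$ with $W$ a window and $t\in\mathbb{R}^3$. Directions and $X$-rays: A direction is an element of the unit sphere $\mathbb{S}^2\subset\mathbb{R}^3$; an $L$-direction is a direction parallel to a non-zero element of $L-L=L$. For a finite set $F\subset\mathbb{R}^3$ and a direction $u$, the $X$-ray $X_uF$ is the function assigning to each line $\ell$ in $\mathbb{R}^3$ parallel to $u$ the number $\operatorname{card}(F\cap\ell)$. A set $\mathcal{E}$ of finite subsets of $\mathbb{R}^3$ is determined by the $X$-rays in the directions of a finite set $U\subset\mathbb{S}^2$ if for all $F,F'\in\mathcal{E}$, $X_uF=X_uF'$ for all $u\in U$ implies $F=F'$. $\mathcal{D}_{<R}(\Lambda)$ is the set of subsets of $\Lambda$ with diameter less than $R$ (these are finite, since $\Lambda$ is uniformly discrete). *)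

(* Defs.v *)
From HB Require Import structures.
From mathcomp Require Import all_boot all_order all_algebra all_fingroup.
From mathcomp Require Import finmap ring.
From mathcomp Require Import all_classical all_reals all_analysis.

Set Implicit Arguments.
Unset Strict Implicit.
Unset Printing Implicit Defensive.

Import Order.TTheory GRing.Theory Num.Theory.
Import numFieldNormedType.Exports.

Local Open Scope classical_set_scope.
Local Open Scope ring_scope.

Section Icosians.
Context {R : realType}.

Definition tau : R := (1 + Num.sqrt 5) / 2.
Definition tau' : R := 1 - tau.

Lemma tau_irrational (q : rat) : tau <> ratr q.
Proof.
move=> h.
have h5 : (2 * q - 1) ^+ 2 = 5 :> rat.
  apply: (fmorph_inj (@ratr R)).
  rewrite rmorphXn rmorphB rmorphM rmorph1 !rmorph_nat /= -h /tau.
  have -> : 2 * ((1 + Num.sqrt 5) / 2) - 1 = Num.sqrt 5 :> R by field.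
  by rewrite sqr_sqrtr.
move: (2 * q - 1) h5 => {h}q h5.
have hn : (numq q ^+ 2 = 5 * denq q ^+ 2)%R.
  by apply/eqP; rewrite -(eqr_int rat) !expr2 !intrM numqE mulrACA -!expr2 h5.
have {}hn : (`|numq q| ^ 2 = 5 * `|denq q| ^ 2)%N.
  by rewrite -!abszX hn abszM.
have d0 : (0 < `|denq q|)%N by rewrite absz_gt0 denq_neq0.
have := congr1 (fun n => odd (logn 5 n)) hn.
by rewrite lognM ?expn_gt0 ?d0// !lognX oddD !oddM.
Qed.

(* The non-trivial automorphism of Q(tau), a + b tau |-> a + b tau'; the pair
   (a, b) is unique because tau is irrational (see galconjE).  The value
   outside Q(tau) is 0 and is irrelevant. *)
Definition galconj (x : R) : R :=
  let p := xget (0, 0)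
    [set p : rat * rat | x = ratr p.1 + ratr p.2 * tau] in
  ratr p.1 + ratr p.2 * tau'.

Lemma galconjE (a b : rat) :
  galconj (ratr a + ratr b * tau) = ratr a + ratr b * tau'.
Proof.
rewrite /galconj; case: xgetP => [[c d] _ /= h|/(_ (a, b))]; last first.
  by move=> /(_ erefl).
have [bd|bd] := eqVneq b d.
  by move: h; rewrite bd => /addIr ->.
case: (@tau_irrational ((c - a) / (b - d))).
have nz : ratr (b - d) != 0 :> R by rewrite fmorph_eq0 subr_eq0.
rewrite fmorph_div /=; apply: (mulIf nz); rewrite mulfVK// !rmorphB/=.
apply/eqP; rewrite -subr_eq0; move/eqP: h; rewrite -subr_eq0.
by congr (_ == 0); ring.
Qed.

Definition star (x : 'rV[R]_3) : 'rV[R]_3 := map_mx galconj x.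

(* Only the additive structure of the quaternions is needed, so
   a + b i + c j + d k is represented by its coordinates (a, b, c, d). *)
Definition quat (a b c d : R) : 'rV[R]_4 := \row_i [:: a; b; c; d]`_i.

Definition Re_quat (x : 'rV[R]_4) : R := x 0 ord0.
Definition Im_quat (x : 'rV[R]_4) : 'rV[R]_3 := \row_i x 0 (lift ord0 i).

(* (1,0,0,0) and its negative; (1,1,1,1)/2 and (0,1,tau',tau)/2 up to signs.
   A Boolean e gives the sign (-1) ^+ e. *)
Definition icosian_seed : set 'rV[R]_4 :=
  [set x | exists e : bool, x = quat ((-1) ^+ e) 0 0 0] `|`
  [set x | exists e0 e1 e2 e3 : bool,
     x = 2^-1 *: quat ((-1) ^+ e0) ((-1) ^+ e1) ((-1) ^+ e2) ((-1) ^+ e3)] `|`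
  [set x | exists e1 e2 : bool,
     x = 2^-1 *: quat 0 ((-1) ^+ e1) ((-1) ^+ e2 * tau') tau].

Definition icosian_gen : set 'rV[R]_4 :=
  [set x | exists (s : 'S_4) (y : 'rV[R]_4),
     [/\ ~~ odd_perm s, icosian_seed y & x = col_perm s y]].

Definition additive_subgroup (V : zmodType) (H : set V) : Prop :=
  H 0 /\ forall x y, H x -> H y -> H (x - y).

Definition icosian : set 'rV[R]_4 :=
  smallest (@additive_subgroup 'rV[R]_4) icosian_gen.

Definition Im_icosian : set 'rV[R]_3 := Im_quat @` icosian.

Definition icosian0 : set 'rV[R]_3 :=
  Im_quat @` [set x | icosian x /\ Re_quat x = 0].

(* The topology on 'rV[R]_3 is the product topology, i.e. the usual one. *)
Definition window (W : set 'rV[R]_3) : Prop :=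
  [/\ W° !=set0, W `<=` closure W° & compact (closure W°)].

Definition Lambda_ico (L : set 'rV[R]_3) (t : 'rV[R]_3) (W : set 'rV[R]_3) :
    set 'rV[R]_3 :=
  [set t + x | x in [set x | L x /\ W (star x)]].

Definition icosahedral_model_set (L Lambda : set 'rV[R]_3) : Prop :=
  exists t W, window W /\ Lambda = Lambda_ico L t W.

(* The norm `|x| provided by the library is the sup norm, hence: *)
Definition enorm (x : 'rV[R]_3) : R := Num.sqrt (\sum_i x 0 i ^+ 2).

(* +oo for unbounded sets; -oo, hence less than every r, for the empty set *)
Definition diam (F : set 'rV[R]_3) : \bar R :=
  ereal_sup [set (enorm (x - y))%:E | x in F & y in F].

Definition bounded_patches (r : R) (Lambda : set 'rV[R]_3) :
    set (set 'rV[R]_3) :=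
  [set F | F `<=` Lambda /\ (diam F < r%:E)%E].

Definition direction (u : 'rV[R]_3) : Prop := enorm u = 1.

Definition parallel (u v : 'rV[R]_3) : Prop :=
  exists2 c : R, c != 0 & v = c *: u.

Definition L_direction (L : set 'rV[R]_3) (u : 'rV[R]_3) : Prop :=
  direction u /\ exists x, [/\ L x, x != 0 & parallel u x].

Definition lines_along (u : 'rV[R]_3) : set (set 'rV[R]_3) :=
  [set l | exists p, l = [set p + c *: u | c in [set: R]]].

(* fset_set A is a junk value when A is infinite; X-rays are only meaningful
   for finite F. *)
Definition Xray (u : 'rV[R]_3) (F : set 'rV[R]_3) : lines_along u -> nat :=
  fun l => #|` fset_set (F `&` val l)|.

Arguments Xray : clear implicits.

Definition determined_by_Xrays (E : set (set 'rV[R]_3)) (U : set 'rV[R]_3) :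
    Prop :=
  forall F F', E F -> E F' -> (forall u, U u -> Xray u F = Xray u F') ->
  F = F'.

End Icosians.

(* Main.v *)
Require Import Defs.
From HB Require Import structures.
From mathcomp Require Import all_boot all_order all_algebra all_fingroup.
From mathcomp Require Import finmap ring lra.
From mathcomp Require Import all_classical all_reals all_analysis.
Set Implicit Arguments.
Unset Strict Implicit.
Unset Printing Implicit Defensive.

Import Order.TTheory GRing.Theory Num.Theory.
Import numFieldNormedType.Exports.

Local Open Scope classical_set_scope.
Local Open Scope ring_scope.

(** Fix a large integer n and take the orthogonal directions u and v of the
    integer vectors (1, n, 0) and (n, -1, 0), which lie in both modules.

    Suppose two distinct points of the model set differ by a multiple
    lambda (1, n, 0).  Coordinates of elements of the module lie in Z[tau] / 2,
    hence so does lambda, and since the norm of a non-zero element of Z[tau] is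
    a non-zero integer, |lambda lambda'| >= 1/4.  The star images of the two
    points (before translation) lie in the bounded window, so n |lambda'| is
    bounded; therefore |lambda| is at least of order n, and the distance of the
    two points at least of order n^2.  The same holds for (n, -1, 0).  So for
    n large, distinct points of the model set on a line parallel to u or v are
    at distance at least r ([model_set_separated]).

    Now let F and F' be patches of diameter less than r with the same X-rays
    along u and v, and let x be in F.  The line through x along u meets F in x
    only, so it meets F' in some x + a u; likewise F' contains some x + b v.
    These two points are at distance sqrt (a^2 + b^2) < r, while |a| >= r unless
    a = 0.  Hence a = 0 and x is in F' ([separated_patch_sub]); exchanging F and
    F' gives equality. *)

(** * The norm form of Z[tau] *)

Section HalfGolden.
Context {R : realType}.

Lemma tau_sqr : tau ^+ 2 = tau + 1 :> R.
Proof.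
have h5 : Num.sqrt 5 ^+ 2 = 5 :> R by rewrite sqr_sqrtr.
rewrite /tau; move: (Num.sqrt 5) h5 => s h5.
have -> : ((1 + s) / 2) ^+ 2 = (1 + 2 * s + s ^+ 2) / 4 by field.
by rewrite h5; field.
Qed.

Lemma golden_normE (a b : int) :
  (a%:~R + b%:~R * tau) * (a%:~R + b%:~R * tau') =
  (a ^+ 2 + a * b - b ^+ 2)%:~R :> R.
Proof.
rewrite rmorphB rmorphD rmorphM !rmorphXn /= /tau'.
have -> : (a%:~R + b%:~R * tau) * (a%:~R + b%:~R * (1 - tau)) =
  a%:~R ^+ 2 + a%:~R * b%:~R + b%:~R ^+ 2 * (tau - tau ^+ 2) :> R by ring.
by rewrite tau_sqr; ring.
Qed.

(** A zero of a + b tau' with b <> 0 would make tau = 1 + a / b rational. *)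
Lemma golden_conj_neq0 (a b : int) : a%:~R + b%:~R * tau != 0 :> R ->
  a%:~R + b%:~R * tau' != 0 :> R.
Proof.
apply: contraNN; rewrite /tau' => /eqP h.
have [b0|b0] := eqVneq b 0; first by move: h; rewrite b0 !mul0r => ->.
have bR : b%:~R != 0 :> R by rewrite intr_eq0.
case: (@tau_irrational R (1 + a%:~R / b%:~R)).
rewrite rmorphD rmorph1 fmorph_div /= !ratr_int.
apply: (mulIf bR); rewrite mulrDl mul1r divfK//.
by apply/eqP; rewrite -subr_eq0 -oppr_eq0 -h; apply/eqP; ring.
Qed.

Lemma golden_norm_ge1 (a b : int) : a%:~R + b%:~R * tau != 0 :> R ->
  1 <= `|(a%:~R + b%:~R * tau) * (a%:~R + b%:~R * tau')| :> R.
Proof.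
move=> nz; apply: norm_intr_ge1; first by rewrite golden_normE intr_int.
by rewrite mulf_neq0 ?golden_conj_neq0.
Qed.

Definition half_golden : set R :=
  [set x | exists a b : int, x = (a%:~R + b%:~R * tau) / 2].

Lemma galconj_half_golden (a b : int) :
  galconj ((a%:~R + b%:~R * tau) / 2) = (a%:~R + b%:~R * tau') / 2 :> R.
Proof.
have := @galconjE R (a%:~R / 2) (b%:~R / 2).
rewrite !fmorph_div /= !ratr_int rmorph_nat => h.
have e (t : R) : a%:~R / 2 + b%:~R / 2 * t = (a%:~R + b%:~R * t) / 2 by ring.
by rewrite -!e.
Qed.

Lemma half_goldenB x y : half_golden x -> half_golden y -> half_golden (x - y).
Proof.
move=> [a [b ->]] [c [d ->]]; exists (a - c), (b - d).
by rewrite !rmorphB /=; ring.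
Qed.

Lemma galconjB x y : half_golden x -> half_golden y ->
  galconj (x - y) = galconj x - galconj y.
Proof.
move=> [a [b ->]] [c [d ->]].
have -> : (a%:~R + b%:~R * tau) / 2 - (c%:~R + d%:~R * tau) / 2 =
    ((a - c)%:~R + (b - d)%:~R * tau) / 2 :> R by rewrite !rmorphB /=; ring.
by rewrite !galconj_half_golden !rmorphB /=; ring.
Qed.

Lemma galconjMz (m : int) x : half_golden x ->
  galconj (m%:~R * x) = m%:~R * galconj x.
Proof.
move=> [a [b ->]].
have -> : m%:~R * ((a%:~R + b%:~R * tau) / 2) =
    ((m * a)%:~R + (m * b)%:~R * tau) / 2 :> R by rewrite !rmorphM /=; ring.
by rewrite !galconj_half_golden !rmorphM /=; ring.
Qed.

(** The constant is the integer bound [golden_norm_ge1] divided by the square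
    of the denominator 2. *)
Lemma half_golden_norm x : half_golden x -> x != 0 -> 4^-1 <= `|x * galconj x|.
Proof.
move=> [a [b ->]]; rewrite mulf_eq0 negb_or => /andP[nz _].
rewrite galconj_half_golden mulrACA normrM.
have -> : `|2^-1 / 2| = 4^-1 :> R by rewrite ger0_norm; [field | lra].
by rewrite ler_peMl ?golden_norm_ge1// invr_ge0.
Qed.

End HalfGolden.

(** * Coordinates of icosians *)

Section Coordinates.
Context {R : realType}.

Lemma icosian_half_golden (x : 'rV[R]_4) : icosian x ->
  forall i, half_golden (x 0 i).
Proof.
move: x; apply: (@smallest_sub _ _ icosian_gen
  [set x : 'rV[R]_4 | forall i, half_golden (x 0 i)]) => [|y [s [z [_ hz ->]]] i].
  split=> [i|y z hy hz i]; first by exists 0, 0; rewrite !mxE; ring.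
  by rewrite !mxE; apply: half_goldenB.
have Hs (a b : int) (e : bool) :
    half_golden (2^-1 * ((-1) ^+ e * (a%:~R + b%:~R * tau)) : R).
  exists ((-1) ^+ e * a), ((-1) ^+ e * b).
  by rewrite !rmorphM /= rmorph_sign; ring.
have H0 : half_golden (0 : R) by exists 0, 0; ring.
have H2 (e : bool) : half_golden (2^-1 * (-1) ^+ e : R).
  by have := Hs 1 0 e; rewrite mul0r addr0 mulr1.
have H1 (e : bool) : half_golden ((-1) ^+ e : R).
  by exists ((-1) ^+ e * 2), 0; rewrite rmorphM /= rmorph_sign; field.
rewrite mxE; move: (s i) => {s}j.
case: hz => [[[e ->]|[e0 [e1 [e2 [e3 ->]]]]]|[e1 [e2 ->]]];
  rewrite !mxE; case: j => [[|[|[|[|//]]]] /= _] //; rewrite ?mulr0 //.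
- by have := Hs 1 (-1) e2; congr half_golden; rewrite /tau'; ring.
- by have := Hs 0 1 false; congr half_golden; ring.
Qed.

Lemma icosian_subgroup : additive_subgroup (@icosian R).
Proof.
split=> [X [[X0 _] _]//|x y hx hy X XG].
by case: (XG) => -[_ XB] _; apply: XB; [apply: hx|apply: hy].
Qed.

(** The seed 1 can be moved to any coordinate by an even permutation: a
    transposition can be made even by composing it with another one that fixes
    the coordinate of the seed. *)
Lemma icosian_delta (i : 'I_4) : icosian (delta_mx 0 i : 'rV[R]_4).
Proof.
apply: sub_gen_smallest.
(* When i is already 0 the second transposition must be trivial, whence the
   case distinction in k. *)
pose j : 'I_4 := lift ord0 ord0.
pose k : 'I_4 := if i == ord0 then j else ord_max.
have s_odd : ~~ odd_perm (tperm i ord0 * tperm j k)%g.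
  by rewrite odd_mul_tperm odd_tperm /k; case: eqP.
exists (tperm i ord0 * tperm j k)%g, (quat 1 0 0 0); split=> //.
  by left; left; exists false.
have si : (tperm i ord0 * tperm j k)%g i = ord0.
  by rewrite permM tpermL tpermD // /k; case: ifP.
apply/rowP => l; rewrite !mxE eqxx /=.
rewrite -(inj_eq (@perm_inj _ (tperm i ord0 * tperm j k)%g) l i) si.
by case: (_ l) => [[|[|[|[|//]]]] /= _].
Qed.

Lemma icosian_int_row (z : 'I_4 -> int) :
  icosian (\row_i (z i)%:~R : 'rV[R]_4).
Proof.
have [I0 IB] := icosian_subgroup.
have IN x : icosian x -> icosian (- x : 'rV[R]_4).
  by move=> hx; rewrite -sub0r; apply: IB.
have ID x y : icosian x -> icosian y -> icosian (x + y : 'rV[R]_4).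
  by move=> hx hy; rewrite -[y]opprK; apply: IB => //; apply: IN.
have IMn x n : icosian x -> icosian (x *+ n : 'rV[R]_4).
  by move=> hx; elim: n => [|n IHn]; rewrite ?mulr0n// mulrS; apply: ID.
rewrite [X in icosian X]row_sum_delta.
apply: (big_ind icosian) => // j _; rewrite mxE scaler_int.
have de := icosian_delta j; case: (z j) => n; first exact: (IMn _ n de).
exact: (IN _ (IMn _ n.+1 de)).
Qed.

(** This supplies explicit elements of both modules, along which the X-rays are
    taken. *)
Lemma icosian0_int_row (w : 'I_3 -> int) :
  icosian0 (\row_i (w i)%:~R : 'rV[R]_3).
Proof.
exists (\row_i (if unlift ord0 i is Some j then w j else 0)%:~R).
  by split; [exact: icosian_int_row | rewrite /Re_quat mxE unlift_none].
by apply/rowP => i; rewrite !mxE liftK.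
Qed.

Lemma icosian0_sub_Im : @icosian0 R `<=` Im_icosian.
Proof. by move=> _ [x [hx _] <-]; exists x. Qed.

Lemma Im_icosian_half_golden (x : 'rV[R]_3) : Im_icosian x ->
  forall i, half_golden (x 0 i).
Proof. by move=> [y /icosian_half_golden hy <-] i; rewrite mxE. Qed.

End Coordinates.

(** * Patches without close collinear points *)

Section Geometry.
Context {R : realType}.
Implicit Types (Lambda F : set 'rV[R]_3) (u v w x y : 'rV[R]_3) (r C : R).

Lemma enorm_ge_coord x i : `|x 0 i| <= enorm x.
Proof.
rewrite -sqrtr_sqr /enorm ler_sqrt ?sqr_ge0 ?sumr_ge0// => [|j _]; last first.
  exact: sqr_ge0.
by rewrite (bigD1 i) //= lerDl sumr_ge0// => j _; apply: sqr_ge0.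
Qed.

Lemma enormZ (c : R) x : enorm (c *: x) = `|c| * enorm x.
Proof.
rewrite /enorm -[X in _ = X * _]sqrtr_sqr -sqrtrM ?sqr_ge0// mulr_sumr.
by congr Num.sqrt; apply: eq_bigr => i _; rewrite mxE exprMn.
Qed.

Lemma enorm_orthonormal u v (a b : R) : direction u -> direction v ->
  \sum_i u 0 i * v 0 i = 0 -> enorm (a *: u - b *: v) = Num.sqrt (a ^+ 2 + b ^+ 2).
Proof.
have unit_sq w : direction w -> \sum_i w 0 i ^+ 2 = 1.
  move=> /(congr1 (fun t => t ^+ 2)); rewrite expr1n sqr_sqrtr// sumr_ge0// => i _.
  exact: sqr_ge0.
move=> /unit_sq u1 /unit_sq v1 uv; congr Num.sqrt.
transitivity (a ^+ 2 * (\sum_i u 0 i ^+ 2) + b ^+ 2 * (\sum_i v 0 i ^+ 2) -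
    2 * a * b * (\sum_i u 0 i * v 0 i)); last by rewrite u1 v1 uv; ring.
rewrite !mulr_sumr -big_split -sumrB /=.
by apply: eq_bigr => i _; rewrite !mxE; ring.
Qed.

Lemma orthonormal_nparallel u v : direction u -> direction v ->
  \sum_i u 0 i * v 0 i = 0 -> ~ parallel u v.
Proof.
move=> u1 v1 uv [c _ vE]; have := enorm_orthonormal c 1 u1 v1 uv.
rewrite vE scale1r subrr -[X in enorm X](scale0r u) enormZ normr0 mul0r expr1n.
move/eqP; rewrite eq_sym sqrtr_eq0; have := sqr_ge0 c; lra.
Qed.

Lemma enorm_gt0 x : x != 0 -> 0 < enorm x.
Proof.
apply: contraNT; rewrite -leNgt => x0; apply/eqP/rowP => i.
apply/eqP; rewrite mxE -normr_le0; exact: le_trans (enorm_ge_coord x i) x0.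
Qed.

Lemma L_direction_normalize (L : set 'rV[R]_3) x : L x -> x != 0 ->
  L_direction L ((enorm x)^-1 *: x).
Proof.
move=> Lx x0; have ex := enorm_gt0 x0; split.
  by rewrite /direction enormZ ger0_norm ?invr_ge0 ?ltW// mulVf ?gt_eqF.
exists x; split=> //; exists (enorm x); first by rewrite gt_eqF.
by rewrite scalerA divff ?scale1r ?gt_eqF.
Qed.

(** Meant for unit vectors u, for which |c| is the distance between the two
    points. *)
Definition separated_along r Lambda u : Prop := forall p (c : R),
  Lambda p -> Lambda (p + c *: u) -> c != 0 -> r <= `|c|.

Lemma bounded_patches_lt r Lambda F x y : bounded_patches r Lambda F ->
  F x -> F y -> enorm (x - y) < r.
Proof.
move=> [_ dF] Fx Fy; rewrite -lte_fin; apply: le_lt_trans dF.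
by apply: ereal_sup_ubound; exists x => //; exists y.
Qed.

(** Separation forces F to meet the line in the single point x, so the X-ray
    value there is 1; the value 1 is in turn incompatible with F' missing the
    line. *)
Lemma Xray_eq_point r Lambda u F F' x : direction u ->
  separated_along r Lambda u -> bounded_patches r Lambda F ->
  @Xray R u F = @Xray R u F' -> F x -> exists c : R, F' (x + c *: u).
Proof.
move=> u1 sep hF eqX Fx.
pose l := [set x + c *: u | c in [set: R]].
have lP : l \in lines_along u by rewrite inE; exists x.
have /(congr1 (fun X => X (SigSub lP))) := eqX; rewrite /Xray /=.
have -> : F `&` l = [set x].
  apply/seteqP; split=> [y [Fy [c _ yE]]|_ ->]; last first.
    by split=> //; exists 0; rewrite // scale0r addr0.
  move: Fy; rewrite -{}yE => Fy.
  have [-> | c0] := eqVneq c 0; first by rewrite /= scale0r addr0.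
  have := bounded_patches_lt hF Fy Fx.
  rewrite addrAC subrr add0r enormZ u1 mulr1 ltNge.
  by rewrite (sep x c) //; apply: hF.1.
rewrite fset_set1 cardfs1 => card1.
have [F'l0|/set0P[y [F'y [c _ yE]]]] := eqVneq (F' `&` l) set0.
  by move: card1; rewrite F'l0 fset_set0 cardfs0.
by exists c; rewrite yE.
Qed.

(** Both points x + a u and x + b v of F' come from the same x, so orthogonality
    makes their distance at least |a|; this is less than r, hence a = 0. *)
Lemma separated_patch_sub r Lambda u v F F' : direction u -> direction v ->
  \sum_i u 0 i * v 0 i = 0 ->
  separated_along r Lambda u -> separated_along r Lambda v ->
  bounded_patches r Lambda F -> bounded_patches r Lambda F' ->
  @Xray R u F = @Xray R u F' -> @Xray R v F = @Xray R v F' -> F `<=` F'.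
Proof.
move=> u1 v1 uv sepu sepv hF hF' equ eqv x Fx.
have [a F'a] := Xray_eq_point u1 sepu hF equ Fx.
have [b F'b] := Xray_eq_point v1 sepv hF eqv Fx.
have := bounded_patches_lt hF' F'a F'b.
rewrite opprD addrACA subrr add0r enorm_orthonormal// ltNge.
have [a0|a0] := eqVneq a 0; first by move: F'a; rewrite a0 scale0r addr0.
suff -> : r <= Num.sqrt (a ^+ 2 + b ^+ 2) by [].
apply: (le_trans (sepu x a (hF.1 _ Fx) (hF'.1 _ F'a) a0)).
by rewrite -sqrtr_sqr ler_sqrt ?addr_ge0 ?sqr_ge0// lerDl sqr_ge0.
Qed.

Lemma separated_determined r Lambda u v : direction u -> direction v ->
  \sum_i u 0 i * v 0 i = 0 ->
  separated_along r Lambda u -> separated_along r Lambda v ->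
  determined_by_Xrays (bounded_patches r Lambda) [set u; v].
Proof.
move=> u1 v1 uv sepu sepv F F' hF hF' eqX.
have equ : @Xray R u F = @Xray R u F' by apply: eqX; left.
have eqv : @Xray R v F = @Xray R v F' by apply: eqX; right.
by apply/seteqP; split; apply: (separated_patch_sub u1 v1 uv sepu sepv).
Qed.

(** * Separation of collinear points in model sets *)

Lemma window_bounded W : window W ->
  exists2 C : R, 0 < C & forall x i, W x -> `|x 0 i| <= C.
Proof.
move=> [_ WW /compact_bounded/pinfty_ex_gt0 [C C0 hC]]; exists C => // x i Wx.
apply: le_trans (hC _ (WW _ Wx)); rewrite [leRHS]/Num.Def.normr /= mx_normrE.
exact: (le_bigmax _ (fun ij : 'I_1 * 'I_3 => `|x ij.1 ij.2|) (0, i)).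
Qed.

Definition int_row (w : 'I_3 -> int) : 'rV[R]_3 := \row_i (w i)%:~R.

(** For c = la * s with s the length of the integer vector w, the window bounds
    |w j| |la'| by 2 C, the norm gives |la la'| >= 1/4, and s >= |w j|; together
    |w j|^2 <= 8 C |c|.  A unit coordinate w i is what puts la itself, rather than
    a multiple of it, in Z[tau] / 2. *)
Lemma model_set_separated (L : set 'rV[R]_3) t W C r (w : 'I_3 -> int) i j :
  (forall x, L x -> forall k, half_golden (x 0 k)) ->
  (forall x k, W x -> `|x 0 k| <= C) ->
  `|w i| = 1 -> 0 < C -> 8 * C * r <= `|w j|%:~R ->
  separated_along r (Lambda_ico L t W) ((enorm (int_row w))^-1 *: int_row w).
Proof.
move=> Lhalf Wbnd wi C0 hr p c [x [Lx Wx] xp] [y [Ly Wy] yp] c0.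
have [wj0|wj0] := eqVneq (w j) 0.
  move: hr; rewrite wj0 normr0 pmulr_rle0 ?mulr_gt0// => /le_trans; apply.
  exact: normr_ge0.
set s := enorm _ in yp *; set la := c / s.
have yxE k : y 0 k - x 0 k = (w k)%:~R * la.
  have -> : y = x + (c / s) *: int_row w.
    apply: (addrI t); rewrite yp -xp scalerA addrA //.
  by rewrite !mxE /la; ring.
have s_ge k : `|w k|%:~R <= s.
  by rewrite intr_norm; have := enorm_ge_coord (int_row w) k; rewrite mxE.
have s_gt0 : 0 < s by apply: lt_le_trans (s_ge j); rewrite ltr0z normr_gt0.
have la0 : la != 0 by apply: mulf_neq0 => //; rewrite invr_neq0 ?gt_eqF.
have lahalf : half_golden la.
  have wiK : (w i)%:~R * (w i)%:~R = 1 :> R.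
    by rewrite -expr2 -real_normK ?num_real// -intr_norm wi expr1n.
  have : half_golden ((w i)%:~R * la) by rewrite -yxE; apply: half_goldenB; apply: Lhalf.
  move=> [a [b e]]; exists (w i * a), (w i * b).
  by rewrite -[LHS]mul1r -[X in X * la]wiK -mulrA e !intrM; ring.
have conj_bnd : `|w j|%:~R * `|galconj la| <= 2 * C.
  rewrite intr_norm -normrM -galconjMz// -yxE galconjB; [|exact: Lhalf..].
  apply: le_trans (ler_normB _ _) _.
  have := Wbnd _ j Wx; have := Wbnd _ j Wy; rewrite !mxE; lra.
have := half_golden_norm lahalf la0; rewrite normrM => nrm.
have cE : `|c| = `|la| * s by rewrite -[in RHS](gtr0_norm s_gt0) -normrM divfK ?gt_eqF.
have n1 : 1 <= `|w j|%:~R :> R by rewrite ler1z -gtz0_ge1 normr_gt0.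
have := s_ge j; rewrite cE; move: (`|w j|%:~R) n1 conj_bnd hr => n n1 cb hr sn.
(* Here n >= 1, so n * n >= n >= 8 C r, and C > 0 cancels. *)
suff : n * n <= 8 * C * (`|la| * s) by nra.
have : n * n / 4 <= n * n * (`|la| * `|galconj la|).
  by rewrite ler_wpM2l// mulr_ge0//; lra.
move=> h.
have : (n * `|la|) * (n * `|galconj la|) <= (s * `|la|) * (2 * C).
  apply: ler_pM => //; rewrite ?mulr_ge0//; try lra.
  by rewrite ler_wpM2r.
move=> h'; move: h h'; move: (`|la|) (`|galconj la|) => A B; lra.
Qed.

End Geometry.

Theorem corollary5p6 (R : realType) (L Lambda : set 'rV[R]_3) (r : R)
    (hL : L = Im_icosian \/ L = icosian0)
    (hLambda : icosahedral_model_set L Lambda) (hr : 0 < r) :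
  exists u v : 'rV[R]_3,
    [/\ L_direction L u, L_direction L v, ~ parallel u v &
        determined_by_Xrays (bounded_patches r Lambda) [set u; v]].
Proof.
have Lhalf x : L x -> forall i, half_golden (x 0 i).
  case: hL => -> Lx i; apply: Im_icosian_half_golden => //.
  exact: icosian0_sub_Im.
have Lint (w : 'I_3 -> int) : L (int_row w).
  have h : icosian0 (int_row w : 'rV[R]_3) by apply: icosian0_int_row.
  by case: hL => ->; [exact: icosian0_sub_Im | exact: h].
have [t [W [/window_bounded[C C0 WC] ->]]] := hLambda.
(* The size demanded by [model_set_separated]. *)
pose n := Num.Def.archi_bound (8 * C * r).
have hn : 8 * C * r <= n%:R by rewrite ltW// archi_boundP// !mulr_ge0 ?ltW.
pose w1 (i : 'I_3) : int := [:: 1; n%:Z; 0]`_i.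
pose w2 (i : 'I_3) : int := [:: n%:Z; -1; 0]`_i.
have row_neq0 w k : `|w k| = 1 -> int_row w != 0 :> 'rV[R]_3.
  apply: contra_eq_neq => /rowP/(_ k)/eqP; rewrite !mxE intr_eq0 => /eqP ->.
  by rewrite normr0.
have d1 := L_direction_normalize (Lint w1) (row_neq0 w1 0 erefl).
have d2 := L_direction_normalize (Lint w2) (row_neq0 w2 1 erefl).
set u := _ *: _ in d1; set v := _ *: _ in d2.
have orth : \sum_i u 0 i * v 0 i = 0.
  rewrite !big_ord_recl big_ord0 !mxE /w1 /w2 /= rmorphN1 rmorph1 rmorph0; ring.
have [[u1 _] [v1 _]] := (d1, d2).
exists u, v; split=> //; first exact: orthonormal_nparallel orth.
apply: separated_determined => //.
- exact: (@model_set_separated _ _ _ _ C _ _ 0 1).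
- by apply: (@model_set_separated _ _ _ _ C _ _ 1 0).
Qed.
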